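(* Let $R$ be an associative algebra with unity over an infinite field $F$, let $\Delta U$ be the $FC$-radical of $U(R)$, and let $t(\Delta U)$ be the torsion subgroup of $\Delta U$. Then: 1. $t(\Delta U)$ is abelian and $\Delta U$ is a nilpotent group of class at most $2$; 2. if every unit of $R$ is algebraic over $F$, then $\Delta U$ is central in $U(R)$.
   Context: $U(R)$ denotes the group of units of $R$. For $a\in U(R)$, $C_{U(R)}(a)=\{u\in U(R)\mid ua=au\}$. The $FC$-radical of $U(R)$ is $\Delta U=\{a\in U(R)\mid [U(R):C_{U(R)}(a)]<\infty\}$. By a theorem of B. H. Neumann, the elements of finite order in $\Delta U$ form a normal subgroup $t(\Delta U)$ and $\Delta U/t(\Delta U)$ is torsion-free abelian. *)

(* Defs.v *)
From HB Require Import structures.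
From mathcomp Require Import all_boot all_order all_algebra.
From mathcomp Require Import boolp classical_sets functions cardinality.

Set Implicit Arguments.
Unset Strict Implicit.
Unset Printing Implicit Defensive.

Import GRing.Theory.
Local Open Scope classical_set_scope.
Local Open Scope group_scope.

(* The library's {unit R} requires R to be finite; this is the same
   construction for an arbitrary unit ring. *)
Section UnitGroup.
Variable R : unitRingType.

Inductive unit_group := UnitOf (x : R) of x \is a GRing.unit.
Definition unit_val (u : unit_group) : R := let: UnitOf x _ := u in x.

HB.instance Definition _ := [isSub for unit_val].
HB.instance Definition _ := [Choice of unit_group by <:].

Definition unit_group1 : unit_group := UnitOf (@unitr1 R).

Fact unit_groupM_subproof (u v : unit_group) :
  (val u * val v)%R \is a GRing.unit.
Proof. by rewrite (unitrMr _ (valP u)) (valP v). Qed.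
Definition unit_groupM (u v : unit_group) : unit_group :=
  UnitOf (unit_groupM_subproof u v).

Fact unit_groupV_subproof (u : unit_group) :
  ((val u)^-1)%R \is a GRing.unit.
Proof. by rewrite unitrV (valP u). Qed.
Definition unit_groupV (u : unit_group) : unit_group :=
  UnitOf (unit_groupV_subproof u).

Fact unit_groupMA : associative unit_groupM.
Proof. by move=> u v w; apply/val_inj/mulrA. Qed.
Fact unit_group1M : left_id unit_group1 unit_groupM.
Proof. by move=> u; apply/val_inj/mul1r. Qed.
Fact unit_groupM1 : right_id unit_group1 unit_groupM.
Proof. by move=> u; apply/val_inj/mulr1. Qed.
Fact unit_groupVM : left_inverse unit_group1 unit_groupV unit_groupM.
Proof. by move=> u; apply/val_inj/(mulVr (valP u)). Qed.
Fact unit_groupMV : right_inverse unit_group1 unit_groupV unit_groupM.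
Proof. by move=> u; apply/val_inj/(mulrV (valP u)). Qed.

HB.instance Definition _ := isGroup.Build unit_group
  unit_groupMA unit_group1M unit_groupM1 unit_groupVM unit_groupMV.

End UnitGroup.

Section GroupNotions.
Variable G : groupType.
Implicit Types (A H : set G) (a x y : G) (n c : nat).

Definition is_subgroup H : Prop := H 1 /\ forall x y, H x -> H y -> H (x / y).

Definition generated A : set G := smallest is_subgroup A.

Definition centralizer a : set G := [set x | commute x a].

Definition group_center : set G := [set x | forall y, commute x y].

Definition lcoset x H : set G := [set x * h | h in H].

(* For a subgroup H this says that the index [G : H] is finite. *)
Definition finite_index H : Prop :=
  finite_set [set lcoset x H | x in [set: G]].

Definition FC_radical : set G := [set a | finite_index (centralizer a)].

Definition torsion A : set G :=
  [set x | A x /\ exists2 n, (0 < n)%N & x ^+ n = 1].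

Definition is_abelian A : Prop := forall x y, A x -> A y -> commute x y.

(* Indexed from 0: lower_central A n is the term usually written
   gamma_(n+1)(A). *)
Fixpoint lower_central A n : set G :=
  if n is n'.+1 then
    generated [set [~ x, y] | x in lower_central A n' & y in A]
  else A.

Definition nilpotent_of_class_le c A : Prop := lower_central A c = [set 1].

(* The centralizers involved below are genuine subgroups, and the FC-radical
   is a group, so that nilpotent_of_class_le applies to it. *)
Lemma centralizer_subgroup a : is_subgroup (centralizer a).
Proof.
split=> [|x y /= cx cy]; first by rewrite /centralizer /= /commute mul1g mulg1.
apply: commute_sym; apply: commuteM; first exact: commute_sym.
by rewrite /commute -[LHS](mulKg y) (mulgA y) cy mulgK.
Qed.

Lemma lcosetP H x y : is_subgroup H ->
  lcoset x H = lcoset y H <-> H (x^-1 * y).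
Proof.
move=> [H1 HF]; split=> [e|Hxy].
  have : lcoset y H y by exists 1 => //; rewrite mulg1.
  by rewrite -e => -[h Hh <-]; rewrite mulKg.
have HV z : H z -> H z^-1 by move=> Hz; rewrite -[z^-1]mul1g; exact: HF.
have HM z t : H z -> H t -> H (z * t).
  by move=> Hz Ht; rewrite -[t]invgK; apply: HF => //; apply: HV.
apply/seteqP; split=> z [h Hh <-].
  exists ((x^-1 * y)^-1 * h); first by apply: HM => //; apply: HV.
  by rewrite invgM invgK !mulgA mulgV mul1g.
exists (x^-1 * y * h); first exact: HM.
by rewrite !mulgA mulgV mul1g.
Qed.

Lemma FC_radical_subgroup : is_subgroup FC_radical.
Proof.
have cosetE a x y := lcosetP x y (centralizer_subgroup a).
split=> [|a b Fa Fb].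
  rewrite /FC_radical /= /finite_index.
  apply: (@sub_finite_set _ _ [set lcoset 1 (centralizer 1)]) => //.
  move=> _ [x _ <-] /=; apply/cosetE.
  by rewrite /centralizer /= /commute mul1g mulg1.
have Fab := finite_setX Fa Fb.
pose rep (p : set G * set G) : G :=
  xget 1 [set x | lcoset x (centralizer a) = p.1 /\
                  lcoset x (centralizer b) = p.2].
apply: (sub_finite_set _
  (finite_image (fun p => lcoset (rep p) (centralizer (a / b))) Fab)).
move=> _ [x _ <-] /=.
exists (lcoset x (centralizer a), lcoset x (centralizer b)).
  by split; exists x.
have [/= ea eb] : [set z | lcoset z (centralizer a) = lcoset x (centralizer a)
   /\ lcoset z (centralizer b) = lcoset x (centralizer b)]
   (rep (lcoset x (centralizer a), lcoset x (centralizer b))).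
  by apply: xgetPex; exists x.
apply: (cosetE _ _ _).2.
move/(cosetE a): ea => ea; move/(cosetE b): eb => eb.
set r := rep _ in ea eb *.
have [_] := centralizer_subgroup (r^-1 * x).
by move=> /(_ _ _ (commute_sym ea) (commute_sym eb)) /commute_sym.
Qed.

End GroupNotions.

Arguments FC_radical G : clear implicits.
Arguments group_center G : clear implicits.

(* The library's algebraicOver requires a field in place of R. *)
Definition algebraic_elt (F : fieldType) (R : algType F) (u : R) : Prop :=
  exists2 p : {poly F}, p != 0%R & horner_alg u p = 0%R.

(* Main.v *)
Require Import Defs.
From mathcomp Require Import all_boot all_order all_algebra.
From mathcomp Require Import boolp classical_sets functions cardinality.

Local Open Scope classical_set_scope.

(** The engine is one computation: an element a of the FC-radical commutes with
    every element x of R that is algebraic over F.  If p(x) = 0 with p nonzero,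
    then x - l is a unit for every scalar l outside the finite set of roots of
    p ([nonroot_unit]).  F being infinite, two of these units, for scalars
    l != m, lie in the same left coset of the centralizer of a, so a commutes
    with (x - l)^-1 (x - m) = 1 + (l - m) (x - l)^-1, hence with (x - l)^-1,
    hence with x ([FC_comm_algebraic]).

    When all units are algebraic this says that the FC-radical is central.  In
    general a unit of finite order is algebraic, being a root of X^n - 1, so
    the torsion units commute with the whole FC-radical; in particular the
    torsion elements of the FC-radical commute with each other.

    It remains to see that a commutator of two elements a, b of the FC-radical
    has finite order, for then it is centralized by the FC-radical, which is
    nilpotent of class at most 2.  This is the theorem of Neumann, obtained
    from the transfer ([FC_commg_torsion]): a and b lie in a group H with a
    central subgroup Z of finite index k; the transfer V : H -> Z is a
    homomorphism to an abelian group, so it kills c = [a, b], while V z = z^k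
    for z in Z; as some power c^m, m > 0, is in Z, it follows that
    c^(m k) = V (c^m) = 1. *)

Section FCRadical.

Set Implicit Arguments.
Unset Strict Implicit.
Unset Printing Implicit Defensive.

Import GRing.Theory.
Local Open Scope group_scope.

Lemma infinite_collision (T : choiceType) (U : Type) (A : set T) (f : T -> U) :
  infinite_set A -> finite_set [set f x | x in A] ->
  exists x y, [/\ A x, A y, x <> y & f x = f y].
Proof.
move=> infA finfA; apply: contrapT => noc; apply: infA.
have injf x y : A x -> A y -> f x = f y -> x = y.
  move=> Ax Ay fxy; apply: contrapT => nxy; apply: noc.
  by exists x, y.
have [[x0 _]|/set0P/negP/negPn/eqP->] := pselect (A !=set0); last first.
  exact: finite_set0.
pose g u := xget x0 [set x | A x /\ f x = u].
apply: (sub_finite_set _ (finite_image g finfA)) => x Ax /=.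
exists (f x); first by exists x.
have [Ag fg] := @xgetPex _ x0 [set y | A y /\ f y = f x]
  (ex_intro _ x (conj Ax erefl)).
exact: injf.
Qed.

(** * Transfer to a central subgroup of finite index *)

Section Transfer.
Variable G : groupType.
Implicit Types (A H Z : set G) (a b c g h x y : G) (X Y : set G).

Lemma subgroupV H x : is_subgroup H -> H x -> H x^-1.
Proof. by case=> H1 HF Hx; rewrite -[x^-1]mul1g; apply: HF. Qed.

Lemma subgroupM H x y : is_subgroup H -> H x -> H y -> H (x * y).
Proof.
move=> sH Hx Hy; rewrite -[y]invgK.
by apply: sH.2 => //; apply: subgroupV.
Qed.

Lemma subgroupX H x n : is_subgroup H -> H x -> H (x ^+ n).
Proof.
move=> sH Hx; elim: n => [|n IHn]; first by rewrite expg0; apply: sH.1.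
by rewrite expgS; apply: subgroupM.
Qed.

(** The transfer is a product over unordered cosets in a group that is not
    assumed abelian; it makes sense because the factors commute. *)
Lemma perm_prod_commute (I : eqType) (r s : seq I) (F : I -> G) :
  (forall i j, commute (F i) (F j)) -> perm_eq r s ->
  \prod_(i <- r) F i = \prod_(i <- s) F i.
Proof.
move=> cF; elim: r s => [|i r IHr] s prs.
  by move: prs; rewrite perm_sym => /perm_nilP ->.
have si : i \in s by rewrite -(perm_mem prs) mem_head.
case/splitPr: si prs => s1 s2 prs.
have {}prs : perm_eq r (s1 ++ s2).
  by rewrite -(perm_cons i) (perm_trans prs) // -[i :: s2]cat1s perm_catCA.
rewrite big_cons (IHr _ prs) !big_cat big_cons /=.
rewrite !mulgA; congr (_ * _).
by apply: commute_prod => j _.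
Qed.

(** The default value 1 keeps the representative of an arbitrary set X inside H,
    so that the facts about [transfer_factor] hold for every X. *)
Definition coset_rep H Z X : G := xget 1 [set x | H x /\ lcoset x Z = X].
Definition coset_act H Z g X : set G := lcoset (g * coset_rep H Z X) Z.
(** The amount by which left multiplication by g fails to carry chosen
    representatives to chosen representatives. *)
Definition transfer_factor H Z g X : G :=
  (coset_rep H Z (coset_act H Z g X))^-1 * (g * coset_rep H Z X).

Lemma coset_rep_in H Z X : is_subgroup H -> H (coset_rep H Z X).
Proof.
move=> sH; rewrite /coset_rep; case: xgetP => [x _ []//|_]; exact: sH.1.
Qed.

Lemma coset_repE H Z x : H x -> lcoset (coset_rep H Z (lcoset x Z)) Z = lcoset x Z.
Proof.
move=> Hx; rewrite /coset_rep.
by have [] := @xgetPex _ (1 : G) [set y | H y /\ lcoset y Z = lcoset x Z]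
  (ex_intro _ x (conj Hx erefl)).
Qed.

Lemma lcoset_coset_rep H Z X : [set lcoset x Z | x in H] X ->
  lcoset (coset_rep H Z X) Z = X.
Proof. by case=> x Hx <-; apply: coset_repE. Qed.

Lemma transfer_factor_in H Z g X : is_subgroup H -> is_subgroup Z -> H g ->
  Z (transfer_factor H Z g X).
Proof.
move=> sH sZ Hg; apply/(lcosetP _ _ sZ); apply: coset_repE.
by apply: subgroupM => //; apply: coset_rep_in.
Qed.

Lemma lcosetMl Z g x y : is_subgroup Z ->
  lcoset (g * x) Z = lcoset (g * y) Z <-> lcoset x Z = lcoset y Z.
Proof.
by move=> sZ; rewrite !(lcosetP _ _ sZ) invgM !mulgA mulgVK.
Qed.

Lemma coset_actM H Z g h X : is_subgroup H -> is_subgroup Z -> H h ->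
  coset_act H Z (g * h) X = coset_act H Z g (coset_act H Z h X).
Proof.
move=> sH sZ Hh; rewrite /coset_act -mulgA; apply/(lcosetMl _ _ _ sZ).
rewrite coset_repE //; apply: subgroupM => //; exact: coset_rep_in.
Qed.

(** The cocycle identity that makes the transfer multiplicative, up to the
    permutation of the cosets by h. *)
Lemma transfer_factorM H Z g h X : is_subgroup H -> is_subgroup Z -> H h ->
  transfer_factor H Z (g * h) X =
  transfer_factor H Z g (coset_act H Z h X) * transfer_factor H Z h X.
Proof.
by move=> sH sZ Hh; rewrite /transfer_factor coset_actM // !mulgA mulgK.
Qed.

Lemma perm_coset_act H Z g (s : seq (set G)) : is_subgroup H -> is_subgroup Z ->
  uniq s -> [set lcoset x Z | x in H] = [set` s] -> H g ->
  perm_eq [seq coset_act H Z g X | X <- s] s.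
Proof.
move=> sH sZ us es Hg.
have mems X : X \in s -> lcoset (coset_rep H Z X) Z = X.
  by move=> Xs; apply: lcoset_coset_rep; rewrite es.
have um : uniq [seq coset_act H Z g X | X <- s].
  rewrite map_inj_in_uniq // => X Y Xs Ys.
  rewrite /coset_act => /(lcosetMl _ _ _ sZ).
  by rewrite !mems.
have sub : {subset [seq coset_act H Z g X | X <- s] <= s}.
  move=> _ /mapP[X Xs ->]; suff : [set` s] (coset_act H Z g X) by [].
  rewrite -es; exists (g * coset_rep H Z X) => //.
  by apply: subgroupM => //; apply: coset_rep_in.
apply: uniq_perm => //.
by have [] := uniq_min_size um sub; rewrite ?size_map.
Qed.


(** For x in H the coset of the intersection is cut out of H by the cosets of
    Z1 and Z2 through x, so it is one of finitely many. *)
Lemma finite_image_coset_setI H Z1 Z2 : is_subgroup H ->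
  is_subgroup Z1 -> is_subgroup Z2 ->
  finite_index Z1 -> finite_index Z2 ->
  finite_set [set lcoset x (H `&` (Z1 `&` Z2)) | x in H].
Proof.
move=> sH s1 s2 f1 f2.
have fin Z : finite_index Z -> finite_set [set lcoset x Z | x in H].
  by apply: sub_finite_set => _ [x _ <-]; exists x.
have := finite_image11 (fun X Y => H `&` (X `&` Y)) (fin _ f1) (fin _ f2).
apply: sub_finite_set => _ [x Hx <-]; exists x => //.
apply/seteqP; split=> y.
  move=> [Hy [[u Zu eu] [v Zv]]]; rewrite -eu in Hy *.
  move=> /mulgI evu; rewrite evu in Zv.
  exists u => //; split=> //; rewrite -(mulKg x u).
  by apply: (subgroupM sH _ Hy); apply: (subgroupV sH).
move=> [z [Hz [Z1z Z2z]] <-]; split; first exact: (subgroupM sH).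
by split; exists z.
Qed.

(** The part of Schur's theorem given by the transfer V : H -> Z: it kills
    commutators and is the [H : Z]-th power map on Z, and some positive power
    of any element of H falls into Z. *)
Lemma central_finite_index_commg_torsion H Z :
  is_subgroup H -> is_subgroup Z -> Z `<=` H ->
  (forall z h, Z z -> H h -> commute z h) ->
  finite_set [set lcoset x Z | x in H] ->
  forall x y, H x -> H y -> exists2 n, (0 < n)%N & [~ x, y] ^+ n = 1.
Proof.
move=> sH sZ ZH cZ finZ x y Hx Hy.
have [s0 es0] := (finite_seqP _).1 finZ.
pose s := undup s0.
have us : uniq s := undup_uniq s0.
have es : [set lcoset x Z | x in H] = [set` s].
  by rewrite es0; apply/seteqP; split=> X /=; rewrite mem_undup.
pose V g := \prod_(X <- s) transfer_factor H Z g X.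
have VZ g : H g -> forall h, H h -> commute (V g) h.
  move=> Hg h Hh; apply: commute_sym; apply: commute_prod => X _.
  by apply: commute_sym; apply: cZ => //; apply: transfer_factor_in.
have HV g : H g -> H (V g).
  move=> Hg; apply: (big_ind H) => [|u v|X _]; first exact: sH.1.
    exact: subgroupM.
  by apply: ZH; apply: transfer_factor_in.
have cF g h X Y : H g -> H h ->
    commute (transfer_factor H Z g X) (transfer_factor H Z h Y).
  move=> Hg Hh; apply: cZ; first exact: transfer_factor_in.
  by apply: ZH; apply: transfer_factor_in.
have VM g h : H g -> H h -> V (g * h) = V g * V h.
  move=> Hg Hh; rewrite /V.
  under eq_bigr => X _ do rewrite transfer_factorM //.
  rewrite prodgM_commute; last by move=> X Y _ _; apply: cF.
  congr (_ * _).
  rewrite -(big_map (coset_act H Z h) xpredT (transfer_factor H Z g)).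
  apply: perm_prod_commute => [X Y|]; first exact: cF.
  exact: perm_coset_act.
have Hc : H [~ x, y].
  have HxV := subgroupV sH Hx; have HyV := subgroupV sH Hy.
  by do !apply: subgroupM => //.
have V1 : V [~ x, y] = 1.
  have Hyx : H (y * x) by apply: subgroupM.
  have /esym := congr1 V (commgC x y).
  rewrite (VM _ _ Hyx Hc) (VM _ _ Hy Hx) (VM _ _ Hx Hy) (VZ _ Hx _ (HV _ Hy)) -[RHS]mulg1.
  by move/mulgI.
have VX n : V ([~ x, y] ^+ n.+1) = 1.
  elim: n => [|n IHn]; first by rewrite expg1.
  by rewrite expgS VM ?V1 ?IHn ?mulg1 //; apply: subgroupX.
have mems X : X \in s -> lcoset (coset_rep H Z X) Z = X.
  by move=> Xs; apply: lcoset_coset_rep; rewrite es.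
have Vz z : Z z -> V z = z ^+ size s.
  move=> Zz; rewrite /V (eq_big_seq (fun=> z)); last first.
    move=> X Xs; have cz := cZ _ _ Zz (coset_rep_in Z X sH).
    have actX : coset_act H Z z X = X.
      rewrite -[RHS](mems X Xs) /coset_act cz; apply/(lcosetP _ _ sZ).
      by rewrite invgM mulgVK; apply: subgroupV.
    by rewrite /transfer_factor actX cz mulKg.
  elim: (s) => [|X r IHr]; first by rewrite big_nil expg0.
  by rewrite big_cons IHr -expgS.
have s_gt0 : (0 < size s)%N.
  have : [set` s] (lcoset 1 Z) by rewrite -es; exists 1 => //; apply: sH.1.
  by rewrite /=; case: (s).
(* Two powers of the commutator share a coset of Z, so a quotient of them,
   again a positive power, is in Z. *)
have finX : finite_set [set lcoset ([~ x, y] ^+ n) Z | n in [set: nat]].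
  apply: sub_finite_set finZ => _ [n _ <-].
  by exists ([~ x, y] ^+ n) => //; apply: subgroupX.
have [i [j [_ _ nij eij]]] := infinite_collision infinite_nat finX.
have [m Zm] : exists m, Z ([~ x, y] ^+ m.+1).
  wlog lt_ij : i j nij eij / (i < j)%N.
    move=> IH; case: (ltngtP i j) => [||/nij//]; first exact: IH.
    by apply: IH => //; apply: nesym.
  exists (j - i).-1; rewrite prednK ?subn_gt0 //.
  move: eij => /(lcosetP _ _ sZ); rewrite -{1}(subnKC (ltnW lt_ij)).
  by rewrite expgnDr mulKg.
exists (m.+1 * size s)%N; first by rewrite muln_gt0.
by rewrite expgnA -Vz // VX.
Qed.


(** With D the intersection of the centralizers of a and b, the centralizer H
    of D contains a and b and centralizes D; so the intersection of H and D is
    central in H, and it has finite index there because D does in G. *)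
Lemma FC_commg_torsion a b : FC_radical G a -> FC_radical G b ->
  exists2 n, (0 < n)%N & [~ a, b] ^+ n = 1.
Proof.
move=> Fa Fb; pose D := centralizer a `&` centralizer b.
pose H := [set x | forall c, D c -> commute c x].
have cG := @centralizer_subgroup G.
have sub_cent (P : set G) : is_subgroup [set x | forall c, P c -> commute c x].
  split=> [c _|x y Hx Hy c Pc]; first exact: commute1.
  by apply: commuteM; [exact: Hx|apply: commuteV; exact: Hy].
have sH : is_subgroup H := sub_cent D.
have finZ := finite_image_coset_setI sH (cG a) (cG b) Fa Fb.
apply: (central_finite_index_commg_torsion sH _ _ _ finZ).
- split; first by split; [exact: sH.1|split; exact: (cG _).1].
  move=> x y [Hx [ax bx]] [Hy [ay b_y]]; split; first exact: sH.2.
  by split; apply: (cG _).2.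
- by move=> x [].
- by move=> z h [_ Dz] /(_ z Dz).
- by move=> c [].
- by move=> c [].
Qed.

Lemma nilpotent_class2 (A : set G) : is_subgroup A ->
  (forall x y z, A x -> A y -> A z -> commute [~ x, y] z) ->
  nilpotent_of_class_le 2 A.
Proof.
move=> sA cA; rewrite /nilpotent_of_class_le /=.
set L := generated [set [~ x, y] | x in A & y in A].
have LC : L `<=` [set x | forall z, A z -> commute x z].
  apply: smallest_sub; last by move=> _ [x Ax [y Ay <-]] z Az; apply: cA.
  split=> [z _|x y cx cy z Az]; first exact/commute_sym/commute1.
  apply: commute_sym; apply: commuteM; first exact/commute_sym/cx.
  by apply: commuteV; apply/commute_sym/cy.
apply/seteqP; split=> [|_ ->]; last by move=> M [[M1 _] _].
apply: smallest_sub.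
  by split=> // x y -> ->; rewrite /= invg1 mulg1.
by move=> _ [x Lx [y Ay <-]]; apply/eqP/commgP/LC.
Qed.

End Transfer.

(** * Algebraic elements commute with the FC-radical *)

Section AlgebraicElements.
Local Open Scope ring_scope.
Variables (F : fieldType) (R : unitAlgType F).

Lemma finite_roots (p : {poly F}) : p != 0 -> finite_set [set l | root p l].
Proof.
move=> p0; apply: contrapT => /(infinite_set_fset (size p))[B Bp].
rewrite leqNgt max_poly_roots //; first by apply/allP => l /Bp.
exact: finmap.fset_uniq.
Qed.

(** X - l divides p - p(l); evaluating at x shows that x - l divides the nonzero
    scalar p(l), on both sides. *)
Lemma nonroot_unit (p : {poly F}) (x : R) (l : F) :
  horner_alg x p = 0 -> ~~ root p l -> x - l%:A \is a GRing.unit.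
Proof.
move=> px0 npl.
have : root (p - p.[l]%:P) l by rewrite rootE !hornerE subrr.
case/factor_theorem=> q eq.
have e : horner_alg x q * (x - l%:A) = - p.[l]%:A.
  have := congr1 (horner_alg x) eq.
  by rewrite rmorphM !rmorphB /= px0 !horner_algC horner_algX sub0r.
have e' : (x - l%:A) * horner_alg x q = - p.[l]%:A.
  have := congr1 (horner_alg x) eq.
  (* Polynomials commute, so the factor X - l may be put on the left. *)
  by rewrite mulrC rmorphM !rmorphB /= px0 !horner_algC horner_algX sub0r.
apply/unitrP; exists (- p.[l]^-1 *: horner_alg x q).
rewrite -scalerAl -scalerAr e e' scaleNr scalerN opprK scalerA mulVf //.
by rewrite scale1r.
Qed.

(** The pigeonhole argument on the units x - l modulo the centralizer of a. *)
Lemma FC_comm_algebraic (a : unit_group R) (x : R) :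
  infinite_set [set: F] -> FC_radical (unit_group R) a -> algebraic_elt x ->
  GRing.comm (val a) x.
Proof.
move=> infF Fa [p p0 px0].
have infA : infinite_set [set l | ~~ root p l].
  apply: sub_infinite_set (infinite_setD infF (finite_roots p0)).
  by move=> l [_ /= /negP].
pose f l : unit_group R := insubd (1%g : unit_group R) (x - l%:A).
have fE l : ~~ root p l -> val (f l) = x - l%:A.
  by move=> /(nonroot_unit px0) u; rewrite val_insubd u.
have finf : finite_set
    [set lcoset (f l) (centralizer a) | l in [set l | ~~ root p l]].
  by apply: sub_finite_set Fa => _ [l _ <-]; exists (f l).
have [l [m [nl nm lm /(lcosetP _ _ (centralizer_subgroup a)) ca]]] :=
  infinite_collision infA finf.
have : val ((f l)^-1 * f m)%g * val a = val a * val ((f l)^-1 * f m)%g.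
  exact: (congr1 (@unit_val R) ca).
have -> : val ((f l)^-1 * f m)%g = 1 + (l - m) *: (x - l%:A)^-1.
  have -> : val ((f l)^-1 * f m)%g = (val (f l))^-1 * val (f m) by [].
  rewrite !fE //.
  have -> : x - m%:A = (x - l%:A) + (l - m)%:A.
    by rewrite scalerBl addrA subrK.
  by rewrite mulrDr mulVr ?(nonroot_unit px0) // -scalerAr mulr1.
move=> /esym; rewrite mulrDr mulrDl mulr1 mul1r => /addrI.
rewrite -scalerAr -scalerAl => /scalerI-/(_ _)/commrV; rewrite invrK => cu.
have -> : x = x - l%:A + l%:A by rewrite subrK.
apply: commrD; first by apply: cu; rewrite subr_eq0; apply/eqP.
by rewrite /GRing.comm -scalerAr -scalerAl mulr1 mul1r.
Qed.

Lemma torsion_algebraic (u : unit_group R) n :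
  (0 < n)%N -> (u ^+ n)%g = 1%g -> algebraic_elt (val u).
Proof.
move=> n0 un; exists ('X^n - 1).
  by rewrite -size_poly_eq0 size_XnsubC.
rewrite rmorphB rmorphXn rmorph1 /= horner_algX.
suff -> : val u ^+ n = val (u ^+ n)%g by rewrite un subrr.
elim: {n0 un} n => [|n IHn]; first by rewrite expr0 expg0.
by rewrite exprS expgS IHn.
Qed.

End AlgebraicElements.
End FCRadical.

Theorem mainTheorem4 (F : fieldType) (R : unitAlgType F)
    (F_infinite : infinite_set [set: F]) :
  (is_abelian (torsion (FC_radical (unit_group R))) /\
   nilpotent_of_class_le 2 (FC_radical (unit_group R))) /\
  ((forall u : unit_group R, algebraic_elt (val u)) ->
   FC_radical (unit_group R) `<=` group_center (unit_group R)).
Proof.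
have comm_alg a u : FC_radical (unit_group R) a -> algebraic_elt (val u) ->
    commute a u.
  by move=> Fa /(FC_comm_algebraic F_infinite Fa) cau; apply: val_inj.
split; last by move=> alg a Fa u; apply: comm_alg.
split.
  by move=> x y [Fx _] [_ [n n0 yn]]; apply/comm_alg/(torsion_algebraic n0).
apply: nilpotent_class2 => [|x y z Fx Fy Fz]; first exact: FC_radical_subgroup.
have [n n0 cn] := FC_commg_torsion Fx Fy.
by apply/commute_sym/comm_alg/(torsion_algebraic n0 cn).
Qed.
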